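(* Let $K$ be a real biquadratic field of type III. Then the log-unit lattice $\Lambda_K$ is not orthogonal.
   Context: A real biquadratic field is $K=\mathbb{Q}(\sqrt{d_1},\sqrt{d_2})$ with $d_1,d_2>0$ rational and none of $d_1,d_2,d_1d_2$ a square in $\mathbb{Q}$. Its Galois group is generated by $\sigma,\tau$ with $\sigma(\sqrt{d_1})=-\sqrt{d_1}$, $\sigma(\sqrt{d_2})=\sqrt{d_2}$, $\tau(\sqrt{d_1})=\sqrt{d_1}$, $\tau(\sqrt{d_2})=-\sqrt{d_2}$. Fix $K\subset\mathbb{R}$ and define $\mathrm{Log}(x)=(\log|x|,\log|\tau(x)|,\log|\sigma(x)|,\log|\sigma\tau(x)|)\in\mathbb{R}^4$; $\Lambda_K=\mathrm{Log}(\mathcal{O}_K^\times)$. Units $u_1,u_2,u_3$ form a system of fundamental units if their Logs form a basis of $\Lambda_K$. Let $\epsilon_i$ be a fundamental unit of $K_i$, where $K_1=\mathbb{Q}(\sqrt{d_1})$, $K_2=\mathbb{Q}(\sqrt{d_2})$, $K_3=\mathbb{Q}(\sqrt{d_1d_2})$; $\sqrt{\alpha}$ denotes an element of $K$ with square $\alpha$. $K$ is of type III if $\sqrt{\epsilon_1\epsilon_2},\sqrt{\epsilon_2\epsilon_3},\sqrt{\epsilon_1\epsilon_3}$ is a system of fundamental units. A lattice is orthogonal if it has a basis of pairwise orthogonal vectors (standard inner product). *)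

(* Defs.v *)
From HB Require Import structures.
From mathcomp Require Import all_boot all_order all_algebra all_field.
From mathcomp Require Import all_classical all_reals all_analysis.

Set Implicit Arguments.
Unset Strict Implicit.
Unset Printing Implicit Defensive.
Import Order.TTheory GRing.Theory Num.Theory.
Local Open Scope ring_scope.

(* A lattice is given by its set of points; its rank may be smaller than the
   dimension of the ambient space. *)
Definition lattice_basis (R : realType) (m n : nat)
    (L : set 'rV[R]_m) (b : 'I_n -> 'rV[R]_m) : Prop :=
  row_free (\matrix_(i < n) b i) /\
  (forall v : 'rV[R]_m,
     L v <-> exists c : 'I_n -> int, v = \sum_(i < n) b i *~ c i).

Definition dotprod (R : realType) (m : nat) (u v : 'rV[R]_m) : R :=
  \sum_(k < m) u 0 k * v 0 k.

Definition orthogonal_lattice (R : realType) (m : nat)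
    (L : set 'rV[R]_m) : Prop :=
  exists (n : nat) (b : 'I_n -> 'rV[R]_m),
    lattice_basis L b /\ (forall i j : 'I_n, i != j -> dotprod (b i) (b j) = 0).

(* A unit of the ring of integers of a number field. *)
Definition integral_unit (K : fieldExtType rat) (x : K) : Prop :=
  [/\ x != 0, integralOver (intr : int -> K) x
    & integralOver (intr : int -> K) x^-1].

(* For a real quadratic subfield F, where the roots of unity are 1 and -1:
   eps generates the units of the ring of integers of F up to sign. *)
Definition fundamental_unit (K : fieldExtType rat) (F : {subfield K})
    (eps : K) : Prop :=
  [/\ eps \in F, integral_unit eps
    & forall u : K, u \in F -> integral_unit u ->
        exists n : int, u = eps ^ n \/ u = - eps ^ n].

(* sqrt1, sqrt2 are the square roots of d1, d2 in K.  A ring endomorphism of K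
   is automatically an automorphism fixing rat, so sigma and tau are elements
   of the Galois group, determined by their values at sqrt1 and sqrt2.  The
   inclusion of K in the real numbers is the field embedding emb. *)
Record real_biquadratic (R : realType) (K : fieldExtType rat) :=
  RealBiquadratic {
    d1 : rat;
    d2 : rat;
    sqrt1 : K;
    sqrt2 : K;
    sigma : {rmorphism K -> K};
    tau : {rmorphism K -> K};
    emb : {rmorphism K -> R};
    d1_gt0 : 0 < d1;
    d2_gt0 : 0 < d2;
    d1_nonsquare : forall q : rat, q ^+ 2 != d1;
    d2_nonsquare : forall q : rat, q ^+ 2 != d2;
    d1d2_nonsquare : forall q : rat, q ^+ 2 != d1 * d2;
    sqrt1_sqr : sqrt1 ^+ 2 = d1%:A;
    sqrt2_sqr : sqrt2 ^+ 2 = d2%:A;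
    gen_by_sqrts : <<1 & [:: sqrt1; sqrt2]>>%VS = fullv;
    sigma_sqrt1 : sigma sqrt1 = - sqrt1;
    sigma_sqrt2 : sigma sqrt2 = sqrt2;
    tau_sqrt1 : tau sqrt1 = sqrt1;
    tau_sqrt2 : tau sqrt2 = - sqrt2
  }.

Definition K1 (R : realType) (K : fieldExtType rat)
  (B : real_biquadratic R K) : {subfield K} := <<1; sqrt1 B>>%AS.
Definition K2 (R : realType) (K : fieldExtType rat)
  (B : real_biquadratic R K) : {subfield K} := <<1; sqrt2 B>>%AS.
Definition K3 (R : realType) (K : fieldExtType rat)
  (B : real_biquadratic R K) : {subfield K} := <<1; sqrt1 B * sqrt2 B>>%AS.

Definition Log (R : realType) (K : fieldExtType rat)
    (B : real_biquadratic R K) (x : K) : 'rV[R]_4 :=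
  \row_(k < 4) ln `|emb B (tnth
    [tuple x; tau B x; sigma B x; sigma B (tau B x)] k)|.

Definition log_unit_lattice (R : realType) (K : fieldExtType rat)
    (B : real_biquadratic R K) : set 'rV[R]_4 :=
  [set v | exists2 x : K, integral_unit x & v = Log B x]%classic.

Definition fundamental_system (R : realType) (K : fieldExtType rat)
    (B : real_biquadratic R K) (u1 u2 u3 : K) : Prop :=
  [/\ integral_unit u1, integral_unit u2, integral_unit u3
    & lattice_basis (log_unit_lattice B)
        (fun i : 'I_3 => Log B (tnth [tuple u1; u2; u3] i))].

(* The fundamental units are only defined up to sign and inversion, and the
   signs matter for the existence of the square roots r_ij of eps_i * eps_j in
   K, hence the existential quantification over the eps_i. *)
Definition type_III (R : realType) (K : fieldExtType rat)
    (B : real_biquadratic R K) : Prop :=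
  exists eps1 eps2 eps3 r12 r23 r13 : K,
    [/\ fundamental_unit (K1 B) eps1,
        fundamental_unit (K2 B) eps2
      & fundamental_unit (K3 B) eps3] /\
    [/\ r12 ^+ 2 = eps1 * eps2,
        r23 ^+ 2 = eps2 * eps3,
        r13 ^+ 2 = eps1 * eps3
      & fundamental_system B r12 r23 r13].

(* Main.v *)
(* Each fundamental unit eps_i has rational norm 1 or -1, so the vectors
   e_i = Log eps_i / 2 are pairwise orthogonal, and type III says that the
   log-unit lattice is spanned by e1 + e2, e2 + e3, e1 + e3: it is
   the lattice of the integral combinations of the e_i whose coefficients have
   an even sum.  In an orthogonal basis, e1 + e2 and e2 + e3 would each be
   a multiple of a single basis vector.  They are not orthogonal, so that it
   would be the same basis vector; but they are not proportional. *)
Require Import Defs.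
From mathcomp Require Import all_boot all_order all_algebra all_field.
From mathcomp Require Import all_classical all_reals all_analysis.
From mathcomp Require Import ring lra zify.

Set Implicit Arguments.
Unset Strict Implicit.
Unset Printing Implicit Defensive.
Import Order.TTheory GRing.Theory Num.Theory.
Local Open Scope ring_scope.

(** * Bilinearity and positivity of the dot product *)

Lemma dotprodC (R : realType) (m : nat) (u v : 'rV[R]_m) :
  dotprod u v = dotprod v u.
Proof. by apply: eq_bigr => k _; rewrite mulrC. Qed.

Lemma dotprodDl (R : realType) (m : nat) (u v w : 'rV[R]_m) :
  dotprod (u + v) w = dotprod u w + dotprod v w.
Proof. by rewrite -big_split; apply: eq_bigr => k _; rewrite mxE mulrDl. Qed.

Lemma dotprodDr (R : realType) (m : nat) (u v w : 'rV[R]_m) :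
  dotprod u (v + w) = dotprod u v + dotprod u w.
Proof. by rewrite ![dotprod u _]dotprodC dotprodDl. Qed.

Lemma dotprodZl (R : realType) (m : nat) (a : R) (u v : 'rV[R]_m) :
  dotprod (a *: u) v = a * dotprod u v.
Proof. by rewrite mulr_sumr; apply: eq_bigr => k _; rewrite mxE mulrA. Qed.

Lemma dotprodZr (R : realType) (m : nat) (a : R) (u v : 'rV[R]_m) :
  dotprod u (a *: v) = a * dotprod u v.
Proof. by rewrite dotprodC dotprodZl dotprodC. Qed.

Lemma dotprod_suml (R : realType) (m n : nat) (P : pred 'I_n)
    (u : 'I_n -> 'rV[R]_m) (v : 'rV[R]_m) :
  dotprod (\sum_(i | P i) u i) v = \sum_(i | P i) dotprod (u i) v.
Proof.
rewrite exchange_big /=; apply: eq_bigr => k _.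
by rewrite summxE mulr_suml.
Qed.

Lemma dotprod_gt0 (R : realType) (m : nat) (u : 'rV[R]_m) :
  u != 0 -> 0 < dotprod u u.
Proof.
have ge0 (k : 'I_m) : true -> 0 <= u 0 k * u 0 k by rewrite -expr2 sqr_ge0.
move=> u_neq0; rewrite lt0r sumr_ge0 // andbT.
apply: contraNneq u_neq0 => /(psumr_eq0P ge0) u0.
apply/eqP/rowP => k; rewrite mxE; apply/eqP.
by rewrite -[_ == 0]orbb -mulf_eq0 u0.
Qed.

(** * Lattices of type D3 and orthogonal bases *)

(** For an orthonormal frame this is the root lattice D3 (face-centred cubic); here the lengths of
    the [e]'s may differ. The integer [k], half the coordinate sum, witnesses its parity. *)
Definition D3_lattice (R : realType) (m : nat) (e1 e2 e3 : 'rV[R]_m)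
    (v : 'rV[R]_m) : Prop :=
  exists x y z k : int, x + y + z = k + k /\
    v = x%:~R *: e1 + y%:~R *: e2 + z%:~R *: e3.

(** This symmetry transfers results about [e1 + e2] to [e2 + e3]. *)
Lemma D3_lattice_rot (R : realType) (m : nat) (e1 e2 e3 v : 'rV[R]_m) :
  D3_lattice e1 e2 e3 v -> D3_lattice e2 e3 e1 v.
Proof.
move=> [x [y [z [k [xyz ->]]]]]; exists y, z, x, k; split; first by lia.
by rewrite -addrA addrC.
Qed.

(** The product is negative only strictly between 0 and 1, where there is no integer. *)
Lemma intr_mul_pred_ge0 (R : realType) (x : int) :
  0 <= x%:~R * (x%:~R - 1) :> R.
Proof.
have -> : x%:~R * (x%:~R - 1) = (x * (x - 1))%:~R :> R.
  by rewrite intrM intrB.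
rewrite ler0z; have [x_le0 | x_gt0] := leP x 0.
  by rewrite mulr_le0 // subr_le0 (le_trans x_le0).
by rewrite mulr_ge0 ?subr_ge0 // ltW.
Qed.

(* A component u of v = e1 + e2 along the orthogonal basis satisfies
   <u, u - v> = 0; in the coordinates (x, y, z) of D3 this reads
   |e1|^2 x(x-1) + |e2|^2 y(y-1) + |e3|^2 z^2 = 0, so that x, y are in {0, 1},
   z = 0, and x = y by parity. *)
Lemma D3_lattice_parallel (R : realType) (m n : nat) (L : set 'rV[R]_m)
    (b : 'I_n -> 'rV[R]_m) (e1 e2 e3 : 'rV[R]_m) :
  e1 != 0 -> e2 != 0 -> e3 != 0 ->
  dotprod e1 e2 = 0 -> dotprod e2 e3 = 0 -> dotprod e3 e1 = 0 ->
  (forall v, L v <-> D3_lattice e1 e2 e3 v) ->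
  lattice_basis L b -> (forall i j, i != j -> dotprod (b i) (b j) = 0) ->
  exists i (c : R), e1 + e2 = c *: b i.
Proof.
move=> e1N0 e2N0 e3N0 e12 e23 e31 LE [_ Lb] borth.
have e21 : dotprod e2 e1 = 0 by rewrite dotprodC.
have e32 : dotprod e3 e2 = 0 by rewrite dotprodC.
have e13 : dotprod e1 e3 = 0 by rewrite dotprodC.
have A0 := dotprod_gt0 e1N0; have B0 := dotprod_gt0 e2N0.
have C0 := dotprod_gt0 e3N0.
have /LE/Lb[c vE] : D3_lattice e1 e2 e3 (e1 + e2).
  exists 1, 1, 0, 1; split; first by lia.
  by rewrite scale0r addr0 !scale1r.
have [i ciN0] : exists i, b i *~ c i != 0.
  apply/existsP; apply: contraT => /existsPn ci0.
  have v0 : e1 + e2 = 0.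
    by rewrite vE big1 // => i _; apply/eqP; rewrite -[_ == _]negbK ci0.
  have : dotprod e1 (e1 + e2) = 0 by rewrite v0 -(scale0r 0) dotprodZr mul0r.
  by rewrite dotprodDr e12 addr0 => A; rewrite A ltxx in A0.
exists i, (c i)%:~R; rewrite scaler_int.
set u := b i *~ c i in ciN0 *.
have /LE[x [y [z [k [xyz uE]]]]] : L u.
  apply/Lb; exists (fun j => if j == i then c i else 0).
  rewrite (bigD1 i) //= eqxx big1 ?addr0 // => j /negPf ->.
  by rewrite mulr0z.
have uv : dotprod (e1 + e2) u = dotprod u u.
  rewrite {1}vE dotprod_suml (bigD1 i) //= big1 ?addr0 // => j ji.
  rewrite /u -[b j *~ _]scaler_int -[b i *~ _]scaler_int.
  by rewrite dotprodZl dotprodZr borth // !mulr0.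
have : dotprod e1 e1 * (x%:~R * (x%:~R - 1)) +
  dotprod e2 e2 * (y%:~R * (y%:~R - 1)) + dotprod e3 e3 * z%:~R ^+ 2 = 0.
  move: uv; rewrite uE !(dotprodDl, dotprodDr, dotprodZl, dotprodZr).
  rewrite e12 e21 e23 e32 e13 e31 => uv; lra.
have Pge0 (A : R) (w : int) : 0 < A -> 0 <= A * (w%:~R * (w%:~R - 1)).
  by move=> /ltW A_ge0; rewrite mulr_ge0 // intr_mul_pred_ge0.
have Cz : 0 <= dotprod e3 e3 * z%:~R ^+ 2 by rewrite mulr_ge0 ?sqr_ge0 ?ltW.
move/eqP; rewrite !paddr_eq0 ?addr_ge0 ?Pge0 //.
rewrite !mulf_eq0 !subr_eq0 (gt_eqF A0) (gt_eqF B0) (gt_eqF C0) /=.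
rewrite orbb -[1]/(1%:~R) -[0]/(0%:~R) !eqr_int => /andP[/andP[x01 y01] z0].
have z_eq0 : z = 0 by apply/eqP.
have xy : x = y by lia.
move: uE; rewrite z_eq0 scale0r addr0 -xy.
case/orP: x01 => /eqP ->; last by rewrite !scale1r.
by rewrite !scale0r addr0 => u0; rewrite u0 eqxx in ciN0.
Qed.

Lemma D3_lattice_not_orthogonal (R : realType) (m : nat) (L : set 'rV[R]_m)
    (e1 e2 e3 : 'rV[R]_m) :
  e1 != 0 -> e2 != 0 -> e3 != 0 ->
  dotprod e1 e2 = 0 -> dotprod e2 e3 = 0 -> dotprod e3 e1 = 0 ->
  (forall v, L v <-> D3_lattice e1 e2 e3 v) ->
  ~ orthogonal_lattice L.
Proof.
move=> e1N0 e2N0 e3N0 e12 e23 e31 LE [n [b [Lb borth]]].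
have LE' v : L v <-> D3_lattice e2 e3 e1 v.
  split=> [/LE/D3_lattice_rot //|/D3_lattice_rot/D3_lattice_rot].
  by move/LE.
have [i [c vE]] := D3_lattice_parallel e1N0 e2N0 e3N0 e12 e23 e31 LE Lb borth.
have [j [d wE]] := D3_lattice_parallel e2N0 e3N0 e1N0 e23 e31 e12 LE' Lb borth.
have e13 : dotprod e1 e3 = 0 by rewrite dotprodC.
have A0 := dotprod_gt0 e1N0; have B0 := dotprod_gt0 e2N0.
(* This product is |e2|^2 > 0 in the frame, but 0 in the orthogonal basis unless [i = j]. *)
have := @erefl _ (dotprod (e1 + e2) (e2 + e3)).
rewrite {1}vE wE dotprodZl dotprodZr -wE.
have [ij | ij] := eqVneq i j; last first.
  rewrite borth // !mulr0 !dotprodDl !dotprodDr e12 e23 e13 => B; lra.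
move=> _; subst j.
have vw : d *: (e1 + e2) = c *: (e2 + e3).
  by rewrite vE wE !scalerA mulrC.
(* Pairing with [e1] kills the right-hand side and leaves d |e1|^2 = 0; then [e2 + e3 = 0], against
   |e2|^2 > 0. *)
have := congr1 (dotprod e1) vw.
rewrite !dotprodZr !dotprodDr e12 e13 => dA.
have d0 : d = 0.
  move: dA; rewrite !addr0 mulr0 => /eqP.
  by rewrite mulf_eq0 (gt_eqF A0) orbF => /eqP.
move: wE; rewrite d0 scale0r => w0.
have : dotprod e2 (e2 + e3) = 0 by rewrite w0 -(scale0r 0) dotprodZr mul0r.
rewrite dotprodDr e23; lra.
Qed.

(** * Integral units, in particular rational ones *)

(** The monic integer polynomial that kills [q] in [K] also kills it in [rat], hence in [algC],
    where rational algebraic integers are known to be integers. *)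
Lemma rational_integer_int (K : fieldExtType rat) (q : rat) :
  integralOver (intr : int -> K) q%:A -> q \is a Num.int.
Proof.
move=> [p p_monic p_root].
have /= : root (map_poly (in_alg K) (map_poly intr p)) (in_alg K q).
  by rewrite -map_poly_comp (eq_map_poly (rmorph_int _)).
rewrite fmorph_root => pq.
have : root (map_poly ratr (map_poly intr p)) (ratr q : algC).
  by rewrite fmorph_root.
rewrite -map_poly_comp (eq_map_poly (rmorph_int _)) => /root_monic_Aint.
have pI : (map_poly intr p : {poly algC}) \is a polyOver Num.int.
  by apply/polyOverP => i; rewrite coef_map intr_int.
move=> /(_ (monic_map _ p_monic) pI) qA.
have /intrP[m qm] := Cint_rat_Aint (Crat_rat q) qA.
apply/intrP; exists m; apply: (fmorph_inj (ratr : {rmorphism rat -> algC})).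
by rewrite /= qm rmorph_int.
Qed.

Lemma rational_integral_unit_norm (K : fieldExtType rat) (q : rat) :
  integral_unit (q%:A : K) -> `|q| = 1.
Proof.
move=> [q_neq0 q_int qV_int].
have /intrP[m qm] := rational_integer_int q_int.
have qVA : (q%:A : K)^-1 = q^-1%:A by rewrite -!in_algE fmorphV.
have /intrP[n qn] : q^-1 \is a Num.int.
  by apply: (@rational_integer_int K); rewrite -qVA.
have q0 : q != 0 by apply: contraNneq q_neq0 => ->; rewrite scale0r.
have : (m * n)%:~R = 1 :> rat by rewrite intrM -qm -qn divff.
rewrite -[1]/(1%:~R) => /intr_inj mn.
have /eqP := congr1 absz mn; rewrite abszM muln_eq1 => /andP[/eqP m1 _].
by rewrite qm -intr_norm -abszE m1.
Qed.

Lemma integral_unit_mul (K : fieldExtType rat) (x y : K) :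
  integral_unit x -> integral_unit y -> integral_unit (x * y).
Proof.
move=> [x0 xi xVi] [y0 yi yVi]; split; first by rewrite mulf_neq0.
  exact: integral_mul.
by rewrite invfM; apply: integral_mul.
Qed.

Lemma integral_unit_rmorph (K : fieldExtType rat) (f : {rmorphism K -> K})
    (x : K) :
  integral_unit x -> integral_unit (f x).
Proof.
have f_int y : integralOver (intr : int -> K) y -> integralOver intr (f y).
  move=> [p p_monic p_root]; exists p => //.
  rewrite -(eq_map_poly (rmorph_int f)) (map_poly_comp f).
  by rewrite fmorph_root.
move=> [x0 xi xVi]; split; rewrite ?fmorph_eq0 -?fmorphV //; exact: f_int.
Qed.

Lemma rmorph_rat_alg (K : fieldExtType rat) (f : {rmorphism K -> K}) (q : rat) :
  f q%:A = q%:A.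
Proof. by rewrite alg_num_field fmorph_rat. Qed.

(** * Conjugation of elements and units in quadratic subfields *)

Lemma Fadjoin_sqrtP (K : fieldExtType rat) (d : rat) (s x : K) :
  s ^+ 2 = d%:A -> x \in <<1; s>>%VS -> exists a b : rat, x = a%:A + b%:A * s.
Proof.
move=> s2 /Fadjoin_polyP[p p_rat ->].
have /polyOver1P[q ->] := p_rat.
elim/poly_ind: q => [|q c [a [b qE]]].
  by exists 0, 0; rewrite rmorph0 horner0 !scale0r mul0r addr0.
(* Horner step: (a + b s) s + c = (b d + c) + a s. *)
exists (b * d + c), a.
rewrite rmorphD rmorphM /= map_polyX map_polyC !hornerE /= qE.
rewrite !scalerDl -!in_algE rmorphM /= -s2; ring.
Qed.

Section QuadraticUnit.
Variables (R : realType) (K : fieldExtType rat) (f : {rmorphism K -> K}).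
Variables (emb : {rmorphism K -> R}) (d : rat) (s x : K).
Hypotheses (s2 : s ^+ 2 = d%:A) (xs : x \in <<1; s>>%VS).

Lemma Fadjoin_sqrt_fixed : f s = s -> f x = x.
Proof.
have [a [b ->]] := Fadjoin_sqrtP s2 xs => fs.
by rewrite rmorphD rmorphM /= !rmorph_rat_alg fs.
Qed.

(** The norm [f x * x] is rational and an integral unit, hence 1 or -1; the logarithms of the
    absolute values of its factors therefore cancel. *)
Lemma ln_quadratic_unit_conj : integral_unit x -> f s = - s ->
  ln `|emb (f x)| = - ln `|emb x|.
Proof.
move=> xu fs; have fxu := integral_unit_rmorph f xu.
have [a [b xE]] := Fadjoin_sqrtP s2 xs.
have fxE : f x = a%:A - b%:A * s.
  by rewrite xE rmorphD rmorphM /= !rmorph_rat_alg fs mulrN.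
have NE : f x * x = (a * a - b * b * d)%:A.
  rewrite -!in_algE rmorphB !rmorphM /= -s2 fxE xE; ring.
have := integral_unit_mul fxu xu.
rewrite NE => /rational_integral_unit_norm N1.
have : `|emb (f x)| * `|emb x| = 1.
  rewrite -normrM -rmorphM NE alg_num_field fmorph_rat.
  by rewrite -(ratr_norm R) N1 rmorph1.
move: xu fxu => [x0 _ _] [fx0 _ _] /(congr1 (@ln R)).
rewrite ln1 lnM ?posrE ?normr_gt0 ?fmorph_eq0 // => /eqP.
by rewrite addr_eq0 => /eqP.
Qed.

End QuadraticUnit.

(** * The log-unit lattice in type III as a D3 lattice *)

Lemma LogM (R : realType) (K : fieldExtType rat) (B : real_biquadratic R K)
    (x y : K) :
  x != 0 -> y != 0 -> Log B (x * y) = Log B x + Log B y.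
Proof.
move=> x0 y0; apply/rowP => k; rewrite !mxE !(tnth_nth 0).
by case: k => [[|[|[|[|//]]]] ?] /=;
  rewrite !rmorphM normrM lnM ?posrE ?normr_gt0 ?fmorph_eq0.
Qed.

Lemma D3_lattice_basis (R : realType) (m : nat) (L : set 'rV[R]_m)
    (b : 'I_3 -> 'rV[R]_m) (e1 e2 e3 : 'rV[R]_m) :
  b 0 = e1 + e2 -> b 1 = e2 + e3 -> b 2 = e1 + e3 -> lattice_basis L b ->
  [/\ e1 != 0, e2 != 0, e3 != 0 & forall v, L v <-> D3_lattice e1 e2 e3 v].
Proof.
move=> b0 b1 b2 [bfree Lb].
have bsum (c : 'I_3 -> R) :
    \sum_i c i *: b i = c 0 *: (e1 + e2) + c 1 *: (e2 + e3) + c 2 *: (e1 + e3).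
  rewrite !big_ord_recl big_ord0 addr0 addrA -b0 -b1 -b2.
  by congr (_ *: b _ + _ *: b _ + _ *: b _); try congr c; apply: val_inj.
(* The first coefficient is enough, since it is 1 or -1 in each relation used below. *)
have indep (c0 c1 c2 : R) :
    c0 *: (e1 + e2) + c1 *: (e2 + e3) + c2 *: (e1 + e3) = 0 -> c0 = 0.
  pose c (i : 'I_3) := if val i == 0 then c0 else if val i == 1 then c1 else c2.
  have -> : c0 *: (e1 + e2) + c1 *: (e2 + e3) + c2 *: (e1 + e3) =
      (\row_i c i) *m \matrix_i b i.
    rewrite mulmx_sum_row -[LHS](bsum c); apply: eq_bigr => i _.
    by rewrite rowK mxE.
  rewrite -(mul0mx 1 (\matrix_i b i)).
  by move/(row_free_inj bfree)/rowP/(_ 0); rewrite !mxE.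
split.
(* The signed sum of the three basis vectors is 2 e1, so [e1 = 0] would make it a nontrivial
   relation. The other two cases use 2 e2 and 2 e3. *)
- apply/eqP => e0; have := indep 1 (-1) 1.
  rewrite e0 !add0r !scaleN1r !scale1r opprD addrA subrr add0r addNr.
  by move=> /(_ erefl)/eqP; rewrite oner_eq0.
- apply/eqP => e0; have := indep 1 1 (-1).
  rewrite e0 add0r addr0 !scaleN1r !scale1r subrr.
  by move=> /(_ erefl)/eqP; rewrite oner_eq0.
- apply/eqP => e0; have := indep (-1) 1 1.
  rewrite e0 !addr0 scaleN1r !scale1r -addrA [e2 + _]addrC addNr.
  by move=> /(_ erefl)/eqP; rewrite oppr_eq0 oner_eq0.
move=> v; rewrite Lb; split.
  move=> [c ->].
  exists (c 0 + c 2), (c 0 + c 1), (c 1 + c 2), (c 0 + c 1 + c 2).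
  split; first by lia.
  under eq_bigr do rewrite -scaler_int.
  rewrite (bsum (fun i => (c i)%:~R)) !intrD.
  by apply/rowP => k; rewrite !mxE; ring.
move=> [x [y [z [k [xyz ->]]]]].
(* Solution of c0 + c2 = x, c0 + c1 = y, c1 + c2 = z: the total of the c's is [k], and each one is
   [k] minus the sum of the other two. *)
pose c (i : 'I_3) := if val i == 0 then k - z else if val i == 1 then k - x
  else k - y.
exists c; under eq_bigr do rewrite -scaler_int.
rewrite (bsum (fun i => (c i)%:~R)) /c /=.
have -> : z = k + k - x - y by lia.
by rewrite !intrB intrD; apply/rowP => j; rewrite !mxE; ring.
Qed.

(** In the coordinates (id, tau, sigma, sigma tau) the Logs of the three fundamental units have the
    shapes (a, a, -a, -a), (b, -b, b, -b) and (c, -c, -c, c). These are multiples of the nontrivial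
    characters of the Galois group, hence pairwise orthogonal. *)
Lemma type_III_D3 (R : realType) (K : fieldExtType rat)
    (B : real_biquadratic R K) :
  type_III B -> exists e1 e2 e3 : 'rV[R]_4,
    [/\ e1 != 0, e2 != 0 & e3 != 0] /\
    [/\ dotprod e1 e2 = 0, dotprod e2 e3 = 0, dotprod e3 e1 = 0
      & forall v, log_unit_lattice B v <-> D3_lattice e1 e2 e3 v].
Proof.
move=> [u1 [u2 [u3 [r12 [r23 [r13 []]]]]]].
move=> [[u1K u1U _] [u2K u2U _] [u3K u3U _]] [r12E r23E r13E [_ _ _ basis]].
have s1 := sqrt1_sqr B; have s2 := sqrt2_sqr B.
have s3 : (sqrt1 B * sqrt2 B) ^+ 2 = (d1 B * d2 B)%:A.
  by rewrite exprMn s1 s2 -!in_algE rmorphM.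
have t1 := Fadjoin_sqrt_fixed s1 u1K (tau_sqrt1 B).
have g2 := Fadjoin_sqrt_fixed s2 u2K (sigma_sqrt2 B).
have g1 := ln_quadratic_unit_conj (emb B) s1 u1K u1U (sigma_sqrt1 B).
have t2 := ln_quadratic_unit_conj (emb B) s2 u2K u2U (tau_sqrt2 B).
have ts3 : tau B (sqrt1 B * sqrt2 B) = - (sqrt1 B * sqrt2 B).
  by rewrite rmorphM /= tau_sqrt1 tau_sqrt2 mulrN.
have gs3 : sigma B (sqrt1 B * sqrt2 B) = - (sqrt1 B * sqrt2 B).
  by rewrite rmorphM /= sigma_sqrt1 sigma_sqrt2 mulNr.
have t3 := ln_quadratic_unit_conj (emb B) s3 u3K u3U ts3.
have g3 := ln_quadratic_unit_conj (emb B) s3 u3K u3U gs3.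
have gt3 : sigma B (tau B u3) = u3.
  apply: (@Fadjoin_sqrt_fixed _ (sigma B \o tau B) _ _ _ s3 u3K).
  by rewrite /= ts3 rmorphN /= gs3 opprK.
have gt2 : ln `|emb B (sigma B (tau B u2))| = - ln `|emb B u2|.
  apply: (@ln_quadratic_unit_conj _ _ (sigma B \o tau B) _ _ _ _ s2 u2K u2U).
  by rewrite /= tau_sqrt2 rmorphN /= sigma_sqrt2.
(* The factor 1/2 comes from the square roots: r^2 = u v gives 2 Log r = Log u + Log v. *)
pose e u := 2^-1 *: Log B u.
have half r u v : integral_unit u -> integral_unit v -> r ^+ 2 = u * v ->
    Log B r = e u + e v.
  move=> [u0 _ _] [v0 _ _] rE.
  have r0 : r != 0 by rewrite -sqrf_eq0 rE mulf_neq0.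
  rewrite /e -scalerDr -LogM // -rE expr2 LogM // scalerDr -scalerDl.
  by rewrite (_ : 2^-1 + 2^-1 = 1) ?scale1r //; lra.
have [] := @D3_lattice_basis _ _ _ _ (e u1) (e u2) (e u3) _ _ _ basis;
  rewrite ?(tnth_nth 0) /=; try exact: half.
move=> e1N0 e2N0 e3N0 LE; exists (e u1), (e u2), (e u3); split=> //.
split=> //; rewrite /dotprod !big_ord_recl big_ord0 !mxE !(tnth_nth 0) /=.
- by rewrite t1 g1 g2 t2 gt2; ring.
- by rewrite t2 g2 gt2 g3 t3 gt3; ring.
- by rewrite t1 g1 g3 t3 gt3; ring.
Qed.

Theorem theorem5p5 (R : realType) (K : fieldExtType rat)
    (B : real_biquadratic R K) :
  type_III B -> ~ orthogonal_lattice (log_unit_lattice B).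
Proof.
move=> /type_III_D3[e1 [e2 [e3 [[? ? ?] [? ? ? LE]]]]].
exact: (@D3_lattice_not_orthogonal _ _ _ e1 e2 e3).
Qed.
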